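(* Let $\Gamma$ be a simple graph and let $\mathrm{Aut}(\Gamma)$ act on the set $\Omega_s(\Gamma)$ of switching equivalence classes of signed graphs on $\Gamma$ by $[\Gamma,\sigma]^\varphi=[\Gamma,\sigma^\varphi]$, where $\sigma^\varphi(uv)=\sigma(\varphi^{-1}(u)\varphi^{-1}(v))$ for $uv\in E_\Gamma$. Two signed graphs $(\Gamma,\sigma_1)$ and $(\Gamma,\sigma_2)$ are switching isomorphic if and only if $[\Gamma,\sigma_1]$ and $[\Gamma,\sigma_2]$ belong to the same orbit. In particular, the number of switching non-isomorphic signed graphs with underlying graph $\Gamma$ (that is, the number of such signed graphs up to switching isomorphism) is equal to the number of orbits of this group action.
   Context: All graphs are finite, simple and undirected. A signed graph is a pair $\Sigma=(\Gamma,\sigma)$ where $\Gamma=(V_\Gamma,E_\Gamma)$ is a graph (the underlying graph) and $\sigma:E_\Gamma\to\{+1,-1\}$ is a sign function. For a switching function $\theta:V_\Gamma\to\{+1,-1\}$, define $\Sigma^\theta=(\Gamma,\sigma^\theta)$ by $\sigma^\theta(uv)=\theta(u)\sigma(uv)\theta(v)$ for every $uv\in E_\Gamma$. Two signed graphs $\Sigma_1,\Sigma_2$ with the same underlying graph $\Gamma$ are switching equivalent if $\Sigma_2=\Sigma_1^\theta$ for some switching function $\theta$; this is an equivalence relation on the set of all signed graphs with underlying graph $\Gamma$. The class of $(\Gamma,\sigma)$ is denoted $[\Gamma,\sigma]$ and the set of all classes is denoted $\Omega_s(\Gamma)$. Two signed graphs $(\Gamma_1,\sigma_1)$ and $(\Gamma_2,\sigma_2)$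 are isomorphic if there is a graph isomorphism $\Gamma_1\to\Gamma_2$ preserving the signs of edges. Two signed graphs $\Sigma_1,\Sigma_2$ are switching isomorphic if $\Sigma_1$ is isomorphic to a signed graph which is switching equivalent to $\Sigma_2$. $\mathrm{Aut}(\Gamma)$ is the group of graph automorphisms of $\Gamma$; the action on $\Omega_s(\Gamma)$ is well defined. *)

(* Defs.v *)
From HB Require Import structures.
From mathcomp Require Import all_boot all_fingroup.

Set Implicit Arguments.
Unset Strict Implicit.
Unset Printing Implicit Defensive.

Record sgraph := SGraph {
  vertex :> finType;
  adj : rel vertex;
  adj_sym : symmetric adj;
  adj_irr : irreflexive adj }.

Section Edges.
Variable G : sgraph.

Definition edges : {set {set G}} :=
  [set e | [exists u : G, exists v : G, adj u v && (e == [set u; v])]].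

Lemma edgesP (e : {set G}) :
  reflect (exists u v : G, adj u v /\ e = [set u; v]) (e \in edges).
Proof.
rewrite inE; apply: (iffP existsP).
  by case=> u /existsP[v /andP[uv /eqP->]]; exists u, v.
by case=> u [v [uv ->]]; exists u; apply/existsP; exists v; rewrite uv eqxx.
Qed.

Definition edge : finType := {e : {set G} | e \in edges}.

Lemma edge_of_subproof (u v : G) : adj u v -> [set u; v] \in edges.
Proof. by move=> uv; apply/edgesP; exists u, v. Qed.

Definition edge_of (u v : G) (uv : adj u v) : edge :=
  Sub [set u; v] (edge_of_subproof uv).

End Edges.

(* The sign group {+1, -1} is represented by (bool, (+)), the boolean b       *)
(* standing for (-1)^b: true is -1, false is +1, and multiplication of signs  *)
(* is addb. A signed graph (G, s) is a graph G with an s : signature G.       *)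
Definition signature (G : sgraph) : finType := {ffun edge G -> bool}.

Section Switching.
Variable G : sgraph.
Implicit Types (s t : signature G) (th : {ffun G -> bool}).

(* The product of th over the two ends of e, times s e; see switchE.          *)
Definition switch th s : signature G :=
  [ffun e : edge G => s e (+) \big[addb/false]_(u in val e) th u].

Lemma switchE th s (u v : G) (uv : adj u v) :
  switch th s (edge_of uv) = th u (+) s (edge_of uv) (+) th v.
Proof.
rewrite ffunE /= (big_setD1 u) ?set21 //= (_ : _ :\ u = [set v]).
  by rewrite big_set1 addbA [s _ (+) _]addbC.
apply/setP=> x; rewrite !inE; have [->|] //= := eqVneq x u.
by case: eqP uv => // ->; rewrite adj_irr.
Qed.

Definition switching_equiv s t : bool :=
  [exists th : {ffun G -> bool}, t == switch th s].

Lemma switching_equiv_refl : reflexive switching_equiv.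
Proof.
move=> s; apply/existsP; exists [ffun=> false]; apply/eqP/ffunP=> e.
by rewrite ffunE big1 ?addbF // => u _; rewrite ffunE.
Qed.

Lemma switching_equiv_sym : symmetric switching_equiv.
Proof.
suff sub s t : switching_equiv s t -> switching_equiv t s.
  by move=> s t; apply/idP/idP; apply: sub.
case/existsP=> th /eqP->; apply/existsP; exists th; apply/eqP/ffunP=> e.
by rewrite !ffunE addbK.
Qed.

Lemma switching_equiv_trans : transitive switching_equiv.
Proof.
move=> t s r /existsP[a /eqP->] /existsP[b /eqP->].
apply/existsP; exists [ffun u => a u (+) b u]; apply/eqP/ffunP=> e.
rewrite !ffunE -addbA -big_split; congr (_ (+) _).
by apply: eq_bigr => u _; rewrite ffunE.
Qed.

Definition switching_class s : {set signature G} :=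
  [set t | switching_equiv s t].

Definition Omega_s : {set {set signature G}} :=
  [set switching_class s | s : signature G].

Lemma eq_switching_class s t :
  (switching_class s == switching_class t) = switching_equiv s t.
Proof.
apply/eqP/idP=> [/setP/(_ t)|st]; first by rewrite !inE switching_equiv_refl.
apply/setP=> r; rewrite !inE; apply/idP/idP; apply: switching_equiv_trans=> //.
by rewrite switching_equiv_sym.
Qed.

End Switching.

Section Isomorphism.
Variables G1 G2 : sgraph.

Definition graph_iso (f : {ffun G1 -> G2}) : bool :=
  [&& injectiveb f, [forall y, y \in codom f]
    & [forall u, forall v, adj (f u) (f v) == adj u v]].

Lemma graph_isoP (f : {ffun G1 -> G2}) :
  reflect (bijective f /\ {mono f : u v / adj u v}) (graph_iso f).
Proof.
apply: (iffP and3P) => [[/injectiveP fI /forallP fS /forallP fA]|[fB fA]].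
  split=> [|u v]; last by apply/eqP; move/forallP: (fA u); apply.
  exists (fun y => iinv (fS y)) => [x|y]; last exact: f_iinv.
  by apply: fI; rewrite f_iinv.
case: (fB) => g fK gK; split.
- by apply/injectiveP; apply: can_inj fK.
- by apply/forallP=> y; rewrite -(gK y) codom_f.
- by apply/forallP=> u; apply/forallP=> v; rewrite fA.
Qed.

Definition signed_iso (s1 : signature G1) (s2 : signature G2) : bool :=
  [exists f : {ffun G1 -> G2}, graph_iso f &&
    [forall e1 : edge G1, forall e2 : edge G2, (val e2 == f @: val e1) ==> (s2 e2 == s1 e1)]].

Lemma signed_isoP (s1 : signature G1) (s2 : signature G2) :
  reflect (exists f : G1 -> G2, [/\ bijective f, {mono f : u v / adj u v} &
             forall (u v : G1) (uv : adj u v) (fuv : adj (f u) (f v)),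
               s2 (edge_of fuv) = s1 (edge_of uv)])
          (signed_iso s1 s2).
Proof.
apply: (iffP existsP) => [[f /andP[/graph_isoP[fB fA] /forallP fs]]|].
  exists f; split=> // u v uv fuv; apply/eqP.
  move/forallP: (fs (edge_of uv)) => /(_ (edge_of fuv)) /implyP; apply.
  by rewrite /= imsetU1 imset_set1.
case=> f [[g fK gK] fA fs]; exists [ffun x => f x]; apply/andP; split.
  apply/graph_isoP; split=> [|u v]; last by rewrite !ffunE fA.
  by exists g => x; rewrite ffunE.
apply/forallP=> -[e1 e1P]; apply/forallP=> -[e2 e2P]; apply/implyP=> /= /eqP E.
case/edgesP: (e1P) => u [v [uv e1E]].
have fuv : adj (f u) (f v) by rewrite fA.
have -> : exist _ e1 e1P = edge_of uv by apply: val_inj.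
have -> : exist _ e2 e2P = edge_of fuv.
  by apply: val_inj; rewrite /= E e1E imsetU1 imset_set1 !ffunE.
by rewrite fs.
Qed.

Definition switching_iso (s1 : signature G1) (s2 : signature G2) : bool :=
  [exists s : signature G2, signed_iso s1 s && switching_equiv s s2].

End Isomorphism.

Local Open Scope group_scope.

Section AutomorphismAction.
Variable G : sgraph.
Implicit Types (s t : signature G) (p q : {perm G}).

Definition Aut_set : {set {perm G}} :=
  [set p : {perm G} | [forall u, forall v, adj (p u) (p v) == adj u v]].

Lemma Aut_setP p : reflect {mono (p : G -> G) : u v / adj u v} (p \in Aut_set).
Proof.
rewrite inE; apply: (iffP forallP) => [pA u v|pA u].
  by apply/eqP; move/forallP: (pA u); apply.
by apply/forallP=> v; rewrite pA.
Qed.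

Lemma Aut_group_set : group_set Aut_set.
Proof.
apply/group_setP; split=> [|p q /Aut_setP pA /Aut_setP qA].
  by apply/Aut_setP=> u v; rewrite !perm1.
by apply/Aut_setP=> u v; rewrite !permM qA pA.
Qed.

Definition AutG : {group {perm G}} := Group Aut_group_set.

(* The image of an edge under an automorphism (e itself if p @: e is not an   *)
(* edge, which does not happen for p in AutG; see edge_imE).                  *)
Definition edge_im p (e : edge G) : edge G := insubd e (p @: val e).

Lemma val_edge_im p (e : edge G) : p \in AutG -> val (edge_im p e) = p @: val e.
Proof.
move/Aut_setP=> pA; rewrite val_insubd ifT //.
case/edgesP: (valP e) => u [v [uv ->]].
by apply/edgesP; exists (p u), (p v); rewrite pA imsetU1 imset_set1.
Qed.

Lemma edge_imE p (u v : G) (uv : adj u v) (puv : adj (p u) (p v)) :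
  p \in AutG -> edge_im p (edge_of uv) = edge_of puv.
Proof.
by move=> pA; apply: val_inj; rewrite val_edge_im //= imsetU1 imset_set1.
Qed.

(* Trivial outside AutG, as the library's actions must be by permutations     *)
(* even outside their domain.                                                 *)
Definition sig_act s p : signature G :=
  if p \in AutG then [ffun e => s (edge_im p^-1 e)] else s.

Lemma sig_actE s p (u v : G) (uv : adj u v) (puv : adj (p^-1 u) (p^-1 v)) :
  p \in AutG -> sig_act s p (edge_of uv) = s (edge_of puv).
Proof.
by move=> pA; rewrite /sig_act pA ffunE (edge_imE _ puv) ?groupV.
Qed.

Lemma edge_imM p q (e : edge G) : p \in AutG -> q \in AutG ->
  edge_im (p * q) e = edge_im q (edge_im p e).
Proof.
move=> pA qA; apply: val_inj; rewrite !val_edge_im ?groupM // -imset_comp.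
by apply: eq_imset => x; rewrite permM.
Qed.

Lemma edge_im1 (e : edge G) : edge_im 1 e = e.
Proof.
apply: val_inj; rewrite val_edge_im ?group1 // -[RHS]imset_id.
by apply: eq_imset => x; rewrite perm1.
Qed.

Lemma sig_act_is_action : is_action AutG sig_act.
Proof.
split=> [p s t|s p q pA qA].
  rewrite /sig_act; case: ifP => // pA /ffunP E; apply/ffunP=> e.
  have := E (edge_im p e).
  by rewrite !ffunE -edge_imM ?groupV // mulgV edge_im1.
apply/ffunP=> e; rewrite /sig_act groupM // pA qA !ffunE.
by rewrite invMg edge_imM ?groupV.
Qed.

Canonical sig_action := Action sig_act_is_action.

(* AutG acts on sets of signatures elementwise; on Omega_s G this is the      *)
(* action [G, s]^p = [G, s^p], see class_actE and Aut_acts_Omega_s.           *)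
Definition class_act : action AutG {set signature G} := (sig_action^*)%act.

Lemma sig_act_switch s p (th : {ffun G -> bool}) : p \in AutG ->
  sig_act (switch th s) p = switch [ffun u => th (p^-1 u)] (sig_act s p).
Proof.
move=> pA; apply/ffunP=> e; rewrite /sig_act pA !ffunE; congr (_ (+) _).
rewrite val_edge_im ?groupV // big_imset /=; last by move=> ? ? _ _ /perm_inj.
by apply: eq_bigr => u _; rewrite ffunE.
Qed.

Lemma sig_act_switching_equiv s t p : p \in AutG ->
  switching_equiv s t -> switching_equiv (sig_act s p) (sig_act t p).
Proof.
move=> pA /existsP[th /eqP->]; rewrite sig_act_switch //.
by apply/existsP; eexists.
Qed.

Lemma class_actE s p : p \in AutG ->
  class_act (switching_class s) p = switching_class (sig_act s p).
Proof.
move=> pA; apply/setP=> t; apply/imsetP/idP=> [[r]|].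
  by rewrite !inE => sr ->; apply: sig_act_switching_equiv.
rewrite inE => st; exists (sig_act t (p^-1)); last first.
  by rewrite -[RHS]/(sig_action (sig_action t p^-1) p) actKVin.
rewrite inE -[s](actKin sig_action pA).
by apply: sig_act_switching_equiv; rewrite ?groupV.
Qed.

Lemma Aut_acts_Omega_s : [acts AutG, on Omega_s G | class_act].
Proof.
apply/subsetP=> p pA; rewrite inE pA inE; apply/subsetP=> C.
by case/imsetP=> s _ ->; rewrite inE class_actE // imset_f.
Qed.

End AutomorphismAction.

(* Main.v *)
(**
Matching the vertices along an isomorphism shows that isomorphic signatures on
one graph are exactly those in one orbit of Aut(G) on signatures. Passing to
switching classes gives the first claim, which says that the
switching-isomorphism class of s is the preimage, under s |-> [G, s], of the
orbit of [G, s]; taking preimages is injective on orbits, hence the count.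
*)
Require Import Defs.
From mathcomp Require Import all_boot all_fingroup.

Set Implicit Arguments.
Unset Strict Implicit.
Unset Printing Implicit Defensive.

Local Open Scope group_scope.

(** Reduces equality of signatures to edges given by their ends, the form in which [sig_actE] and
    [signed_isoP] apply. *)
Lemma signature_eqP (G : sgraph) (s t : signature G) :
  (forall (u v : G) (uv : adj u v), s (edge_of uv) = t (edge_of uv)) -> s = t.
Proof.
move=> st; apply/ffunP=> -[e eP]; case/edgesP: (eP) => u [v [uv eE]].
by have -> : exist _ e eP = edge_of uv by apply: val_inj.
Qed.

(** An isomorphism from G to itself is a permutation in [AutG G]; its sign condition, read at the
    preimages of the ends of an edge, is the formula for [sig_act]. *)
Lemma signed_iso_sig_actP (G : sgraph) (s t : signature G) :
  reflect (exists2 p, p \in AutG G & t = sig_act s p) (signed_iso s t).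
Proof.
apply: (iffP (signed_isoP s t)) => [[f [fB fA fs]]|[p pA ->]].
  pose p := perm (bij_inj fB).
  have pA : p \in AutG G by apply/Aut_setP=> u v; rewrite !permE fA.
  have fpK u : f (p^-1 u) = u by rewrite -[f _](permE (bij_inj fB)) permKV.
  exists p => //; apply: signature_eqP => u v uv.
  have puv : adj (p^-1 u) (p^-1 v) by rewrite -fA !fpK.
  have fpuv : adj (f (p^-1 u)) (f (p^-1 v)) by rewrite fA.
  rewrite (sig_actE _ _ puv) // -(fs _ _ puv fpuv); congr (t _).
  (* The two edges carry different adjacency proofs, so they are compared as vertex sets. *)
  by apply: val_inj; rewrite /= !fpK.
exists p; split=> [||u v uv puv]; first exact: injF_bij perm_inj.
  exact/Aut_setP.
have ppuv : adj (p^-1 (p u)) (p^-1 (p v)) by rewrite !permK.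
rewrite (sig_actE _ _ ppuv) //; congr (s _).
by apply: val_inj; rewrite /= !permK.
Qed.

Lemma switching_iso_orbit (G : sgraph) (s t : signature G) :
  switching_iso s t =
  (switching_class t \in orbit (class_act G) (AutG G) (switching_class s)).
Proof.
apply/existsP/imsetP=> [[r /andP[/signed_iso_sig_actP[p pA ->] st]]|[p pA E]].
  exists p; rewrite // class_actE //; apply/eqP.
  by rewrite eq_sym eq_switching_class.
(* By [E] and [class_actE], the class of this signature is that of [t]. *)
exists (sig_act s p); apply/andP; split.
  by apply/signed_iso_sig_actP; exists p.
by rewrite -eq_switching_class E class_actE.
Qed.

Lemma card_switching_iso_classes (G : sgraph) :
  #|equivalence_partition (@switching_iso G G) [set: signature G]|
    = #|orbit (class_act G) (AutG G) @: Omega_s G|.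
Proof.
pose pre (O : {set {set signature G}}) := [set t | switching_class t \in O].
have blockE s : [set t in setT | switching_iso s t]
    = pre (orbit (class_act G) (AutG G) (switching_class s)).
  by apply/setP=> t; rewrite !inE switching_iso_orbit.
have -> : equivalence_partition (@switching_iso G G) setT
    = pre @: (orbit (class_act G) (AutG G) @: Omega_s G).
  rewrite /Omega_s -!imset_comp; apply/setP=> B.
  by apply/imsetP/imsetP=> -[s _ ->]; exists s; rewrite ?inE //= blockE.
apply: card_in_imset => O1 O2 /imsetP[_ /imsetP[s _ ->] ->].
(* Equal preimages, tested at [s], put the class of [s] in both orbits; orbits that meet
   coincide. *)
case/imsetP=> _ /imsetP[t _ ->] -> /setP/(_ s).
rewrite !inE orbit_refl => /esym sOt.
exact/orbit_in_eqP.
Qed.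

Theorem lemma2p5 (G : sgraph) :
  (forall s1 s2 : signature G,
     switching_iso s1 s2 <->
     switching_class s2 \in orbit (class_act G) (AutG G) (switching_class s1))
  /\
  #|equivalence_partition (@switching_iso G G) [set: signature G]|
    = #|orbit (class_act G) (AutG G) @: Omega_s G|.
Proof.
split=> [s1 s2|]; first by rewrite switching_iso_orbit.
exact: card_switching_iso_classes.
Qed.
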